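(* Let $n \ge 1$, $A \in \mathbb{R}^{n \times n}$, $b, c \in \mathbb{R}^n$, $\mu \in \mathbb{R}$, and consider the Filippov system $$\dot{x} = \begin{cases} A x + b \mu, & x_1 < 0, \\ c, & x_1 > 0, \end{cases} \qquad x = (x_1,\ldots,x_n) \in \mathbb{R}^n .$$ Let $q^{\sf T} = e_1^{\sf T} \, {\rm adj}(A)$ be the first row of the adjugate of $A$. Let $x^L(\mu) = -A^{-1} b \mu$ be the equilibrium of the left piece (when $\det(A) \neq 0$), and let $x^S(\mu)$ be the pseudo-equilibrium of the system (unique when $\det(A) \ne 0$, $c_1 \ne 0$ and $q^{\sf T} c \ne 0$). If $\det(A) \ne 0$, $c_1 \ne 0$, $q^{\sf T} c \ne 0$, and $x^L(\mu)$ and $x^S(\mu)$ are virtual, then every Filippov solution to the system diverges as $t \to \infty$.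
   Context: $e_1$ is the first standard basis vector of $\mathbb{R}^n$, and a subscript $1$ on a vector denotes its first component. ${\rm adj}(A)$ is the adjugate matrix: ${\rm adj}(A)_{ij} = (-1)^{i+j} m_{ji}$, where $m_{ji}$ is the determinant of the matrix obtained by removing row $j$ and column $i$ from $A$. Write $f^L(x;\mu) = Ax + b\mu$, $f^R(x;\mu) = c$, and let $\Sigma = \{ x \in \mathbb{R}^n \mid x_1 = 0 \}$ be the switching manifold. A subset $S \subset \Sigma$ is a crossing region if $f^L_1(x;\mu) f^R_1(x;\mu) > 0$ for all $x \in S$, and a sliding region if $f^L_1(x;\mu) f^R_1(x;\mu) < 0$ for all $x \in S$. The sliding vector field is $$f^S(x;\mu) = \frac{f^L_1(x;\mu) f^R(x;\mu) - f^R_1(x;\mu) f^L(x;\mu)}{f^L_1(x;\mu) - f^R_1(x;\mu)},$$ defined at points of $\Sigma$ where the denominator is nonzero. Filippov solutions (Filippov's convention) are concatenations of smooth segments of motion in $x_1 < 0$ under $f^L$, in $x_1 > 0$ under $f^R$, and on sliding regions (attracting or repelling) under $f^S$. Equivalently, they are absolutely continuous functions $\phi(t)$ such that, for almost every $t$, $\dot\phi(t) = f^L(\phi(t);\mu)$ if $\phi_1(t)<0$, $\dot\phi(t) = f^R(\phi(t);\mu)$ if $\phi_1(t) > 0$, and $\dot\phi(t)$ belongs to the convex hull of $\{f^L(\phi(t);\mu), f^R(\phi(t);\mu)\}$ if $\phi_1(t) = 0$. Solutions are considered for all $t \ge 0$ and need not be unique; a solution diverges as $t \to \infty$ if $\|\phi(t)\|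 \to \infty$ as $t \to \infty$, where $\|\cdot\|$ is the Euclidean norm. The equilibrium $x^L(\mu)$ is virtual if $x^L_1(\mu) > 0$ (and admissible if $x^L_1(\mu) < 0$). A point $x \in \Sigma$ is a pseudo-equilibrium if $f^S(x;\mu) = 0$; it is virtual if it belongs to a crossing region (and admissible if it belongs to a sliding region). *)

(* Defs.v *)
(* Vectors of R^n, n >= 1, are columns
   'cV[R]_n.+1; the first component x_1 is x ord0 ord0. *)
From HB Require Import structures.
From mathcomp Require Import all_boot all_order all_algebra.
From mathcomp Require Import all_classical all_reals all_analysis.
Import Order.TTheory GRing.Theory Num.Theory.
Import numFieldNormedType.Exports.

Set Implicit Arguments.
Unset Strict Implicit.
Unset Printing Implicit Defensive.

Local Open Scope classical_set_scope.
Local Open Scope ring_scope.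

(* The library's norm on matrices is the sup norm. *)
Definition enorm (R : realType) (n : nat) (x : 'cV[R]_n.+1) : R :=
  Num.sqrt (\sum_i x i ord0 ^+ 2).

Section FilippovSystem.
Variables (R : realType) (n : nat).
Variables (A : 'M[R]_n.+1) (b c : 'cV[R]_n.+1) (mu : R).
Implicit Types (x : 'cV[R]_n.+1) (S : set 'cV[R]_n.+1).

Definition fL x : 'cV[R]_n.+1 := A *m x + mu *: b.

Definition fR x : 'cV[R]_n.+1 := c.

Definition Sigma : set 'cV[R]_n.+1 := [set x | x ord0 ord0 = 0].

Definition crossing_region S : Prop :=
  S `<=` Sigma /\ forall x, S x -> 0 < fL x ord0 ord0 * fR x ord0 ord0.

(* Meaningful only where the denominator is nonzero. *)
Definition fS x : 'cV[R]_n.+1 :=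
  (fL x ord0 ord0 - fR x ord0 ord0)^-1 *:
    (fL x ord0 ord0 *: fR x - fR x ord0 ord0 *: fL x).

Definition pseudo_equilibrium x : Prop :=
  [/\ Sigma x, fL x ord0 ord0 - fR x ord0 ord0 != 0 & fS x = 0].

Definition virtual_pseudo_equilibrium x : Prop :=
  pseudo_equilibrium x /\ exists2 S, crossing_region S & S x.

Definition xL : 'cV[R]_n.+1 := - (invmx A *m (mu *: b)).

Definition segment_hull x y : set 'cV[R]_n.+1 :=
  [set v | exists2 s : R, 0 <= s <= 1 & v = s *: x + (1 - s) *: y].

Definition filippov_rhs x : set 'cV[R]_n.+1 :=
  if x ord0 ord0 < 0 then [set fL x]
  else if 0 < x ord0 ord0 then [set fR x]
  else segment_hull (fL x) (fR x).

End FilippovSystem.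

Definition absolutely_continuous_on (R : realType) (n : nat) (a b : R)
    (phi : R -> 'cV[R]_n.+1) : Prop :=
  forall e : R, 0 < e -> exists2 d : R, 0 < d &
    forall (m : nat) (u v : 'I_m -> R),
      (forall i, [/\ a <= u i, u i <= v i & v i <= b]) ->
      trivIset [set: 'I_m] (fun i => `]u i, v i[%classic : set R) ->
      \sum_i (v i - u i) < d ->
      \sum_i enorm (phi (v i) - phi (u i)) < e.

(* Solutions live on [0, +oo[, where absolute continuity is meant on each
   compact subinterval; the values of phi at negative times are irrelevant. *)
Definition filippov_solution (R : realType) (n : nat) (A : 'M[R]_n.+1)
    (b c : 'cV[R]_n.+1) (mu : R) (phi : R -> 'cV[R]_n.+1) : Prop :=
  (forall T : R, 0 <= T -> absolutely_continuous_on 0 T phi) /\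
  {ae (@lebesgue_measure R), forall t : R, 0 < t ->
    exists2 v : 'cV[R]_n.+1, is_derive t 1 phi v &
      filippov_rhs A b c mu (phi t) v}.

Definition diverges (R : realType) (n : nat) (phi : R -> 'cV[R]_n.+1) : Prop :=
  enorm (phi t) @[t --> +oo] --> +oo.

(* Main.v *)
(* Let z(x) = e_1^T A^-1 x = q^T x / det A.  On x_1 <= 0 the left field gives
   z' = x_1 - xL_1 <= -xL_1 < 0.  A virtual pseudo-equilibrium satisfies
   A xS + b mu = alpha c with alpha > 0, and applying e_1^T A^-1 yields
   alpha z(c) = -xL_1, so z' = z(c) < 0 on x_1 > 0 too; convex combinations keep
   the bound on Sigma.  Thus z decreases at a uniform rate along every Filippov
   solution, and |z| is bounded by a multiple of the Euclidean norm. *)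
Require Import Defs.
From HB Require Import structures.
From mathcomp Require Import all_boot all_order all_algebra.
From mathcomp Require Import all_classical all_reals all_analysis.
From mathcomp Require Import measurable_realfun ring lra.
Import Order.TTheory GRing.Theory Num.Theory.
Import numFieldNormedType.Exports.

Set Implicit Arguments.
Unset Strict Implicit.
Unset Printing Implicit Defensive.

Local Open Scope classical_set_scope.
Local Open Scope ring_scope.

(** * Increment bounds from an almost everywhere derivative bound *)

(** The local step at the supremum of the points satisfying [P] starts from such a point just below
    it and jumps across: either [b] is reached or the supremum is exceeded. This replaces the
    extraction of a tagged partition. *)
Lemma cousin_induction (R : realType) (a b : R) (P : R -> Prop) :
  a <= b -> P a ->
  (forall t, a <= t <= b -> exists2 d, 0 < d & forall p q,
     [/\ a <= p, p <= t, t <= q & q <= b] -> t - d < p -> q < t + d ->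
     P p -> P q) ->
  P b.
Proof.
move=> leab Pa step; pose E := [set t | a <= t <= b /\ P t].
have supE : has_sup E.
  by split; [exists a; rewrite /E /= lexx leab | exists b => t [/andP[]]].
have les : a <= sup E.
  by apply: ub_le_sup; [case: supE | rewrite /E /= lexx leab].
have sle : sup E <= b by apply: ge_sup; [case: supE | move=> t [/andP[]]].
have [|d d0 {}step] := step (sup E); first by rewrite les sle.
have [p [/andP[lep pleb] Pp] ltp] := sup_adherent d0 supE.
have ples : p <= sup E.
  by apply: ub_le_sup; [case: supE | rewrite /E /= lep pleb].
have [ltb|leb] := ltP b (sup E + d); first exact: (step p b).
pose q := sup E + d / 2.
have ltq : q < sup E + d by rewrite /q; lra.
have Pq : P q by apply: (step p) => //; split=> //; rewrite /q; lra.
suff : q <= sup E by rewrite /q; lra.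
apply: ub_le_sup; first by case: supE.
by split=> //; rewrite /q; apply/andP; split; lra.
Qed.

(** Since [p] and [q] straddle [t], the increment splits at [t] into two difference quotients based
    at [t], each below [k] near [t]. *)
Lemma derive_lt_increment (R : realType) (f : R -> R) (t v k : R) :
  is_derive t 1 f v -> v < k ->
  exists2 d, 0 < d & forall p q, p <= t -> t <= q -> t - d < p -> q < t + d ->
    f q - f p <= k * (q - p).
Proof.
move=> [df Df] vk.
have /cvgrPdist_lt/(_ (k - v)) :
    h^-1 *: (f (h *: 1 + t) - f t) @[h --> 0^'] --> v.
  by rewrite -Df; exact: df.
rewrite subr_gt0 => /(_ vk) [d /= d0 dP]; exists d => // p q pt tq dp dq.
have slope h : `|h| < d -> h != 0 -> h^-1 * (f (h + t) - f t) < k.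
  move=> hd h0; have /= := dP h; rewrite /ball_/= sub0r normrN => /(_ hd h0).
  by rewrite /GRing.scale /= mulr1 ltr_norml => /andP[]; lra.
have right : f q - f t <= k * (q - t).
  have [->|qt] := eqVneq q t; first by rewrite !subrr mulr0.
  have qt0 : 0 < q - t by rewrite subr_gt0 lt_neqAle eq_sym qt.
  have := slope (q - t); rewrite subrK gtr0_norm// gt_eqF// mulrC.
  by rewrite ltr_pdivrMr// => /(_ _ isT) /ltW; apply; lra.
have left : f t - f p <= k * (t - p).
  have [->|pt'] := eqVneq p t; first by rewrite !subrr mulr0.
  have tp0 : 0 < t - p by rewrite subr_gt0 lt_neqAle pt'.
  have := slope (p - t); rewrite subrK distrC gtr0_norm// lt_eqF; last by lra.
  rewrite -[X in X * _]opprK -invrN opprB mulNr -mulrN opprB mulrC.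
  by rewrite ltr_pdivrMr// => /(_ _ isT) /ltW; apply; lra.
by lra.
Qed.

Lemma sum_disjoint_itv_le (R : realType) (U : set R) (m : nat)
    (u v : nat -> R) :
  open U -> (forall i, (i < m)%N -> u i <= v i /\ `]u i, v i[%classic `<=` U) ->
  trivIset `I_m (fun i => `]u i, v i[%classic : set R) ->
  ((\sum_(i < m) (v i - u i))%:E <= lebesgue_measure U)%E.
Proof.
move=> oU uvU triv.
have mI i : measurable (`]u i, v i[%classic : set R) by exact: measurable_itv.
rewrite -sumEFin.
rewrite (eq_bigr (fun i : 'I_m =>
  lebesgue_measure (`]u i, v i[%classic : set R))).
  rewrite -(@measure_semi_additive_ord_I _ _ _ lebesgue_measure
    (fun i => `]u i, v i[%classic))//; last exact: bigsetU_measurable.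
  apply: le_measure; rewrite ?inE.
  - exact: bigsetU_measurable.
  - exact: open_measurable.
  - move=> x; rewrite -(bigcup_mkord m (fun i => `]u i, v i[%classic)).
    by move=> -[i im]; exact: (uvU i im).2.
move=> i _; rewrite lebesgue_measure_itv /= lte_fin.
by case: ltgtP (uvU i (ltn_ord i)).1 => // -> _; rewrite subrr.
Qed.

Definition real_absolutely_continuous_on (R : realType) (a b : R)
    (f : R -> R) :=
  forall e : R, 0 < e -> exists2 d : R, 0 < d &
    forall (m : nat) (u v : 'I_m -> R),
      (forall i, [/\ a <= u i, u i <= v i & v i <= b]) ->
      trivIset [set: 'I_m] (fun i => `]u i, v i[%classic : set R) ->
      \sum_i (v i - u i) < d ->
      \sum_i `|f (v i) - f (u i)| < e.

(* Cousin-type partition of [a, b]: around a point where the derivative exists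
   the increment is at most (k + e) times the length, while the pieces around
   exceptional points lie in an open set of small measure, where absolute
   continuity bounds the total increment by e. *)
Lemma ac_derive_le_increment (R : realType) (f : R -> R) (a b k : R) :
  a <= b -> real_absolutely_continuous_on a b f ->
  {ae (@lebesgue_measure R), forall t, a < t ->
     exists2 v, is_derive t 1 f v & v <= k} ->
  f b - f a <= k * (b - a).
Proof.
move=> leab acf aef.
suff H e : 0 < e -> f b - f a <= (k + e) * (b - a) + (e + e).
  apply/ler_addgt0Pr => e e0.
  have ba : 0 < b - a + 2 by lra.
  (* Scaled so that the total slack [e' * (b - a) + e' + e'] is exactly [e]. *)
  set e' := e / (b - a + 2); have e'0 : 0 < e' by rewrite divr_gt0.
  have : e' * (b - a + 2) = e by rewrite divfK// gt_eqF.
  by have := H _ e'0; lra.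
move=> e0; have [d1 d10 dP] := acf e e0.
(* The first bound keeps the increments over exceptional pieces below [e], the second keeps [|k|]
   times their total length below [e]; the [+ 1] covers [k = 0]. *)
pose d := Num.min d1 (e / (`|k| + 1)).
have d0 : 0 < d by rewrite lt_min d10 divr_gt0// ltr_wpDl.
have [N [mN N0 sub]] := aef.
(* The derivative is only given for [a < t], so [a] counts as exceptional. *)
have mNa : measurable (N `|` [set a]) by apply: measurableU.
have Na0 : lebesgue_measure (N `|` [set a]) = 0%E.
  apply: measure_negligible => //; apply: negligibleU.
    by apply/negligibleP.
  by apply/negligibleP => //; exact: lebesgue_measure_set1.
have [U [oU NU UNd]] : exists U : set R, [/\ open U, N `|` [set a] `<=` U
    & (lebesgue_measure (U `\` (N `|` [set a])) < d%:E)%E].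
  by apply: lebesgue_regularity_outer => //; rewrite [X in (X < _)%E]Na0.
have Ud : (lebesgue_measure U < d%:E)%E.
  have mD := measurableD (open_measurable oU) mNa.
  rewrite -[U](setDUK NU); apply: le_lt_trans (measureU2 _ mNa mD) _.
  by rewrite [X in (X + _ < _)%E]Na0 add0e.
(* The pieces [u i], [v i] with [i < m] are the exceptional ones met up to [t]. Indexing by [nat]
   lets a new piece be stored at index [m]. *)
pose good t m (u v : nat -> R) :=
  [/\ forall i, (i < m)%N ->
       [/\ a <= u i, u i <= v i, v i <= t & `]u i, v i[%classic `<=` U],
     trivIset `I_m (fun i => `]u i, v i[%classic : set R) &
     f t - f a <= (k + e) * (t - a) +
       \sum_(i < m) (`|f (v i) - f (u i)| + `|k| * (v i - u i))].
have [m [u [v [uvP triv fba]]]] : exists m u v, good b m u v.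
  apply: (@cousin_induction _ a b (fun t => exists m u v, good t m u v)) => //.
    exists 0%N, (fun=> a), (fun=> a); split=> //.
    by rewrite big_ord0 !subrr mulr0 addr0.
  move=> t /andP[lea leb].
  have [NUt|NUt] := pselect ((N `|` [set a]) t).
    have := NU _ NUt; move: oU; rewrite openE => /[apply] -[r /= r0 rU].
    exists r => // p q [ap pt tq qb] rp rq [m [u [v [uvP triv fpa]]]].
    exists m.+1, (fun i => if i == m then p else u i),
      (fun i => if i == m then q else v i).
    split.
    - move=> i; rewrite ltnS leq_eqVlt; case: eqVneq => [->|_] /=.
        move=> _; split=> //; first exact: le_trans tq.
        move=> x /=; rewrite in_itv/= => /andP[px xq]; apply: rU.
        by rewrite /ball/= ltr_norml; apply/andP; split; lra.
      by move=> /uvP[? ? vp ?]; split=> //; lra.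
    - move=> i j /=; rewrite !ltnS (leq_eqVlt i) (leq_eqVlt j).
      have disj l x : (l < m)%N ->
          `]u l, v l[%classic x -> `]p, q[%classic x -> False.
        move=> /uvP[_ _ vp _] /=; rewrite !in_itv/= => /andP[_ xv] /andP[px _].
        by lra.
      case: (eqVneq i m) => [->|_] /=; case: (eqVneq j m) => [->|_] //=.
      + by move=> _ jm [x [xpq xuv]]; case: (disj j x).
      + by move=> im _ [x [xuv xpq]]; case: (disj i x).
      + exact: triv.
    - rewrite big_ord_recr/= eqxx.
      under eq_bigr => i _ do rewrite (ltn_eqF (ltn_ord i)).
      have := ler_norm (f q - f p).
      (* The term in [|k|] compensates for [(k + e) * (q - p)], which may be negative. *)
      have : - `|k| * (q - p) <= (k + e) * (q - p).
        apply: ler_wpM2r; first lra.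
        by have := lerNnormlW (lexx `|k|); lra.
      by lra.
  have at_ : a < t.
    by rewrite lt_neqAle lea andbT; apply/eqP => at_; apply: NUt; right.
  have [w fw wk] : exists2 v, is_derive t 1 f v & v <= k.
    have [//|Q] := pselect (a < t -> exists2 v, is_derive t 1 f v & v <= k).
      exact.
    by case: NUt; left; exact: sub.
  (* The slack [e] supplies the strict inequality; no piece is added here. *)
  have [|r r0 rP] := @derive_lt_increment _ _ _ _ (k + e) fw; first lra.
  exists r => // p q [ap pt tq qb] rp rq [m [u [v [uvP triv fpa]]]].
  exists m, u, v; split=> //.
    by move=> i /uvP[? ? vp ?]; split=> //; lra.
  by have := rP p q pt tq rp rq; lra.
have uvd : \sum_(i < m) (v i - u i) < d.
  rewrite -lte_fin; apply: le_lt_trans Ud; apply: sum_disjoint_itv_le => //.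
  by move=> i /uvP[].
apply: (le_trans fba); rewrite lerD2l big_split/= -mulr_sumr lerD//.
  apply/ltW/(dP m (u \o val) (v \o val)) => [i||] /=.
  - by have [] := uvP i (ltn_ord i).
  - by move=> i j _ _ ij; apply: val_inj; apply: triv => //=; exact: ltn_ord.
  - by apply: lt_le_trans uvd _; rewrite /d ge_min lexx.
have k1 : 0 < `|k| + 1 by rewrite ltr_wpDl.
rewrite (@le_trans _ _ ((`|k| + 1) * (e / (`|k| + 1))))//.
  rewrite ler_pM ?sumr_ge0 ?lerDl//.
    by move=> i _; have [_ ? _ _] := uvP i (ltn_ord i); rewrite subr_ge0.
  by apply/ltW/(lt_le_trans uvd); rewrite /d ge_min lexx orbT.
by rewrite mulrC divfK// gt_eqF.
Qed.

(** * Linear functionals along curves *)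

Section LinearFunctional.
Variables (R : realType) (n : nat) (w : 'rV[R]_n.+1).

Local Notation L := (fun x : 'cV[R]_n.+1 => (w *m x) ord0 ord0).

Lemma norm_mulmx_le_enorm (x : 'cV[R]_n.+1) :
  `|L x| <= (\sum_i `|w ord0 i|) * enorm x.
Proof.
rewrite /= mxE mulr_suml; apply: le_trans (ler_norm_sum _ _ _) _.
apply: ler_sum => i _; rewrite normrM ler_wpM2l// -sqrtr_sqr ler_wsqrtr//.
by rewrite (bigD1 i)//= lerDl sumr_ge0// => j _; exact: sqr_ge0.
Qed.

Lemma mulmx_row_continuous : continuous (L : 'cV[R]_n.+1 -> R).
Proof.
rewrite (_ : L = fun y => \sum_i w ord0 i * y i ord0); last first.
  by apply/funext => y; rewrite mxE.
apply: continuous_big => [|i _ x]; first exact: add_continuous.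
by apply: (continuous_comp (@coord_continuous R n.+1 1 i ord0 x));
  exact: mulrl_continuous.
Qed.

(** The functional commutes with difference quotients and, being continuous, with their limit. *)
Lemma is_derive_mulmx_row (phi : R -> 'cV[R]_n.+1) (t : R) v :
  is_derive t 1 phi v -> is_derive t 1 (fun s => L (phi s) : R) (L v).
Proof.
move=> [dphi <-].
suff C : h^-1 *: (((fun s => L (phi s) : R) \o shift t) (h *: 1) - L (phi t))
    @[h --> 0^'] --> L ('D_1 phi t).
  by apply: DeriveDef; [exact: cvgP C | exact: cvg_lim C].
have := cvg_comp _ _ dphi (@mulmx_row_continuous ('D_1 phi t)).
apply: cvg_trans; apply: near_eq_cvg; apply: nearW => h /=.
by rewrite -scalemxAr mulmxBr !mxE.
Qed.

Lemma ac_mulmx_row (a b : R) (phi : R -> 'cV[R]_n.+1) :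
  absolutely_continuous_on a b phi ->
  real_absolutely_continuous_on a b (fun s => L (phi s)).
Proof.
move=> acphi e e0.
(* A Lipschitz constant for the functional, made positive by the [+ 1]. *)
pose C := \sum_i `|w ord0 i| + 1.
have C0 : 0 < C by rewrite ltr_wpDl// sumr_ge0.
have [d d0 dP] := acphi (e / C) (divr_gt0 e0 C0).
exists d => // m u v uv triv suv.
have := dP m u v uv triv suv; rewrite ltr_pdivlMr//; apply: le_lt_trans.
rewrite mulr_suml; apply: ler_sum => i _.
have -> : L (phi (v i)) - L (phi (u i)) = L (phi (v i) - phi (u i)).
  by rewrite /= mulmxBr !mxE.
apply: le_trans (norm_mulmx_le_enorm _) _.
by rewrite mulrC ler_wpM2l ?sqrtr_ge0// lerDl.
Qed.

End LinearFunctional.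

(** * The functional $e_1^T A^{-1}$ on the Filippov field *)

Section DecreasingFunctional.
Variables (R : realType) (n : nat).
Variables (A : 'M[R]_n.+1) (b c : 'cV[R]_n.+1) (mu : R).
Hypothesis detA_neq0 : \det A != 0.

Local Notation L :=
  (fun x : 'cV[R]_n.+1 => (row ord0 (invmx A) *m x) ord0 ord0).

Lemma row_invmx_fL x : L (fL A b mu x) = x ord0 ord0 - xL A b mu ord0 ord0.
Proof.
have uA : A \in unitmx by rewrite unitmxE unitfE.
by rewrite -row_mul /fL mulmxDr mulKmx// /xL !mxE opprK.
Qed.

(** With [p] and [q] the first components of the left and right fields at [xS], [fS = 0] gives
    [p * L c = - q * xL_1]. Multiplying by [q] yields [p * q * L c = - q^2 * xL_1 < 0], and
    [p * q > 0] by crossing. *)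
Lemma row_invmx_c_lt0 xS :
  0 < xL A b mu ord0 ord0 -> virtual_pseudo_equilibrium A b c mu xS -> L c < 0.
Proof.
move=> xL0 [[xS1 den fS0] [S [_ crossS] SxS]].
have := crossS _ SxS; rewrite /fR => cross.
have /eqP := fS0; rewrite /fS scaler_eq0 invr_eq0 (negPf den) /= subr_eq0.
move=> /eqP.
move=> /(congr1 L); rewrite /fR -!scalemxAr.
rewrite [LHS]mxE [RHS]mxE row_invmx_fL xS1 sub0r => eqL.
set p := fL _ _ _ _ _ _ in cross eqL; set q := c ord0 ord0 in cross eqL.
have q0 : q != 0 by apply: contraTneq cross => ->; rewrite mulr0 ltxx.
rewrite -(pmulr_rlt0 _ cross) mulrAC eqL mulrN mulNr oppr_lt0.
by rewrite mulrAC -expr2 mulr_gt0// exprn_even_gt0.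
Qed.

Lemma filippov_rhs_row_invmx_le x v :
  filippov_rhs A b c mu x v ->
  L v <= Num.max (- xL A b mu ord0 ord0) (L c).
Proof.
rewrite /filippov_rhs; case: ifPn => [x1 ->|].
  by rewrite row_invmx_fL le_max; apply/orP; left; lra.
rewrite -leNgt => x1; case: ifPn => [x2 ->|]; first by rewrite le_max lexx orbT.
rewrite -leNgt => x2 [s /andP[s0 s1] ->].
have x0 : x ord0 ord0 = 0 by lra.
have LE : L (s *: fL A b mu x + (1 - s) *: fR c x) =
    s * - xL A b mu ord0 ord0 + (1 - s) * L c.
  rewrite mulmxDr -!scalemxAr [LHS]mxE [X in X + _]mxE [X in _ + X]mxE.
  by rewrite row_invmx_fL x0 sub0r.
rewrite LE; set M := Num.max _ _.
have M1 : - xL A b mu ord0 ord0 <= M by rewrite le_max lexx.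
have M2 : L c <= M by rewrite le_max lexx orbT.
by nra.
Qed.

End DecreasingFunctional.

Theorem theorem4 (R : realType) (n : nat) (A : 'M[R]_n.+1)
    (b c : 'cV[R]_n.+1) (mu : R)
    (detA_neq0 : \det A != 0)
    (c1_neq0 : c ord0 ord0 != 0)
    (qc_neq0 : (row ord0 (\adj A) *m c) ord0 ord0 != 0)
    (xL_virtual : 0 < xL A b mu ord0 ord0)
    (xS : 'cV[R]_n.+1)
    (xS_virtual : virtual_pseudo_equilibrium A b c mu xS) :
  forall phi : R -> 'cV[R]_n.+1,
    filippov_solution A b c mu phi -> diverges phi.
Proof.
move=> phi [acphi aephi].
pose w := row ord0 (invmx A); pose z t := (w *m phi t) ord0 ord0.
pose k := Num.max (- xL A b mu ord0 ord0) ((w *m c) ord0 ord0).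
have k0 : k < 0.
  have zc0 := row_invmx_c_lt0 detA_neq0 xL_virtual xS_virtual.
  by rewrite gt_max oppr_lt0 xL_virtual zc0.
have zt t : 0 <= t -> z t <= z 0 + k * t.
  move=> t0; rewrite -lerBlDl -[X in k * X]subr0.
  apply: ac_derive_le_increment => //; first exact/ac_mulmx_row/acphi.
  (* The null set of the solution also serves for [z]. *)
  have [N [mN N0 sub]] := aephi; exists N; split=> //.
  apply: subset_trans sub; apply: subsetC => s /= + s0 => /(_ s0)[v dv rhs].
  exists ((w *m v) ord0 ord0); first exact: is_derive_mulmx_row.
  exact: filippov_rhs_row_invmx_le rhs.
pose C := \sum_i `|w ord0 i| + 1.
have C0 : 0 < C by rewrite ltr_wpDl// sumr_ge0.
apply/cvgryPge => M.
near=> t.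
have t0 : 0 <= t by near: t; apply: nbhs_pinfty_ge; exact: num_real.
(* From this time on [z 0 + k * t <= - (C * M)], hence [C * M <= - z t <= C * enorm (phi t)]. *)
have tM : (C * M + z 0) / - k <= t by near: t; apply: nbhs_pinfty_ge; exact: num_real.
rewrite ler_pdivrMr ?oppr_gt0// in tM.
rewrite -(ler_pM2l C0).
have zC : `|z t| <= C * enorm (phi t).
  apply: le_trans (norm_mulmx_le_enorm _ _) _.
  by rewrite ler_wpM2r ?sqrtr_ge0// lerDl.
have /lerNnormlW := zC.
by have := zt t t0; lra.
Unshelve. all: by end_near. Qed.
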